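(* Let $\mathfrak g$ be a $3$-graded Lie algebra over $\mathbb K$ with grading element $E$ and let $\underline{\mathfrak g}\subseteq\mathfrak g$ be an inner $3$-graded subalgebra containing $\mathfrak g_{+}$ and $\mathfrak g_{-}$. Let $G,H,P^\pm$ and $\underline G,\underline H,\underline P^\pm$ be the projective elementary groups and subgroups associated with $\mathfrak g$ and $\underline{\mathfrak g}$, respectively. There is a surjective restriction homomorphism $$R:G\to\underline G,\quad g\mapsto g|_{\underline{\mathfrak g}},\qquad\text{with}\quad R^{-1}(\underline H)=H\quad\text{and}\quad R^{-1}(\underline P^\pm)=P^\pm.$$ For the corresponding homogeneous spaces, we have $$\underline G/\underline P^\pm\cong G/P^\pm\quad\text{and}\quad\underline G/\underline H\cong G/H$$ as homogeneous spaces of $G$.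
   Context: $\mathbb K$ is a commutative ring with unit in which $2,3$ are invertible. A $3$-graded Lie algebra with grading element $E$ is a Lie algebra $\mathfrak g=\mathfrak g_+\oplus\mathfrak g_0\oplus\mathfrak g_-$ where $E\in\mathfrak g$ satisfies $\mathrm{ad}(E)^3=\mathrm{ad}(E)$ and $\mathfrak g_\pm=\mathfrak g_{\pm1}$, $\mathfrak g_0$ are the eigenspaces of $\mathrm{ad}(E)$ for $\pm1$ and $0$. An inner $3$-graded subalgebra containing $\mathfrak g_\pm$ is a subalgebra $\underline{\mathfrak g}=\mathfrak g_+\oplus(\underline{\mathfrak g}\cap\mathfrak g_0)\oplus\mathfrak g_-$ such that this $3$-grading of $\underline{\mathfrak g}$ is the eigenspace decomposition (for $1,0,-1$) of $\mathrm{ad}(\underline E)|_{\underline{\mathfrak g}}$ for some $\underline E\in\underline{\mathfrak g}$. For $x\in\mathfrak g_\pm$, $e^{\mathrm{ad}\,x}=1+\mathrm{ad}\,x+\frac12(\mathrm{ad}\,x)^2\in\mathrm{Aut}(\mathfrak g)$. With $D=\mathrm{ad}(E)$: $G\subset\mathrm{Aut}(\mathfrak g)$ is the group generated by all $e^{\mathrm{ad}\,x}$, $x\in\mathfrak g_+\cup\mathfrak g_-$; $U^\pm=e^{\mathrm{ad}\,\mathfrak g_\pm}$; $H=\{h\in G:hD=Dh\}$; $P^\pm=HU^\pm$. The groups $\underline G\subset\mathrm{Aut}(\underline{\mathfrak g})$, $\underline U^\pm$, $\underline H$, $\underline P^\pm=\underline H\,\underline U^\pm$ are defined in the same way from $\underline{\mathfrak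 g}$ and its grading derivation. $G$ acts on $\underline G/\underline P^\pm$ and $\underline G/\underline H$ via $R$. *)

(* Defs.v *)
From HB Require Import structures.
From mathcomp Require Import all_boot all_order all_algebra.
From mathcomp Require Import boolp classical_sets.

Set Implicit Arguments.
Unset Strict Implicit.
Unset Printing Implicit Defensive.

Import GRing.Theory.
Local Open Scope classical_set_scope.
Local Open Scope ring_scope.

Definition nat_invertible (K : comPzRingType) (n : nat) : Prop :=
  exists c : K, n%:R * c = 1.

(* A [comPzRingType] has no inversion operator; [inv2 K] is the inverse of 2
   as soon as there is one (junk value 0 otherwise). *)
Definition inv2 (K : comPzRingType) : K := xget 0 [set c : K | 2%:R * c = 1].

Lemma inv2E (K : comPzRingType) : nat_invertible K 2 -> 2%:R * inv2 K = 1.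
Proof. by case=> c c2; rewrite /inv2; case: xgetP => [x _ //|/(_ c)]. Qed.

HB.mixin Record isLieAlgebra (K : comPzRingType) L of GRing.Lmodule K L := {
  lie : L -> L -> L;
  lieDZl : forall (a : K) (x y z : L),
    lie (a *: x + y) z = a *: lie x z + lie y z;
  lieDZr : forall (a : K) (x y z : L),
    lie z (a *: x + y) = a *: lie z x + lie z y;
  liexx : forall x : L, lie x x = 0;
  lie_jacobi : forall x y z : L,
    lie x (lie y z) + lie y (lie z x) + lie z (lie x y) = 0
}.

#[short(type="lieAlgType")]
HB.structure Definition LieAlgebra (K : comPzRingType) :=
  {L of isLieAlgebra K L & GRing.Lmodule K L}.

HB.mixin Record isLieClosed (K : comPzRingType) (L : lieAlgType K)
    (S : {pred L}) := {
  lie_closed : {in S &, forall x y : L, lie x y \in S}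
}.

#[short(type="lieClosed")]
HB.structure Definition LieClosed (K : comPzRingType) (L : lieAlgType K) :=
  {S of isLieClosed K L S & GRing.SubmodClosed K S}.

Definition sub_lie (K : comPzRingType) (L : lieAlgType K) (S : lieClosed L)
  : Type := {x : L | x \in S}.

Section SubLie.
Variables (K : comPzRingType) (L : lieAlgType K) (S : lieClosed L).

HB.instance Definition _ := SubChoice.on (sub_lie S).
HB.instance Definition _ := [SubChoice_isSubLmodule of sub_lie S by <:].

Let sub_bracket (x y : sub_lie S) : sub_lie S :=
  Sub (lie (val x) (val y)) (lie_closed _ _ (valP x) (valP y)).

Fact sub_lieDZl (a : K) (x y z : sub_lie S) :
  sub_bracket (a *: x + y) z = a *: sub_bracket x z + sub_bracket y z.
Proof. by apply: val_inj; rewrite /= lieDZl. Qed.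

Fact sub_lieDZr (a : K) (x y z : sub_lie S) :
  sub_bracket z (a *: x + y) = a *: sub_bracket z x + sub_bracket z y.
Proof. by apply: val_inj; rewrite /= lieDZr. Qed.

Fact sub_liexx (x : sub_lie S) : sub_bracket x x = 0.
Proof. by apply: val_inj; rewrite /= liexx. Qed.

Fact sub_lie_jacobi (x y z : sub_lie S) :
  sub_bracket x (sub_bracket y z) + sub_bracket y (sub_bracket z x)
    + sub_bracket z (sub_bracket x y) = 0.
Proof. by apply: val_inj; rewrite /= lie_jacobi. Qed.

HB.instance Definition _ := isLieAlgebra.Build K (sub_lie S)
  sub_lieDZl sub_lieDZr sub_liexx sub_lie_jacobi.

Lemma val_lie (x y : sub_lie S) : val (lie x y) = lie (val x) (val y).
Proof. by []. Qed.

End SubLie.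

Record lie_aut (K : comPzRingType) (L : lieAlgType K) := LieAut {
  aut_fun :> L -> L;
  aut_inv : L -> L;
  autDZ : forall (a : K) (x y : L),
    aut_fun (a *: x + y) = a *: aut_fun x + aut_fun y;
  aut_lie : forall x y : L, aut_fun (lie x y) = lie (aut_fun x) (aut_fun y);
  autK : cancel aut_fun aut_inv;
  aut_invK : cancel aut_inv aut_fun
}.

Section AutGroup.
Variables (K : comPzRingType) (L : lieAlgType K).
Implicit Types f g h : lie_aut L.

Lemma lie_autP f g : f =1 g -> f = g.
Proof.
case: f g => [f f' fDZ fL fK f'K] [g g' gDZ gL gK g'K] /= fg.
have {}fg : f = g by apply: funext.
move: fDZ fL fK f'K; rewrite fg => fDZ fL fK f'K.
have fg' : f' = g' by apply: funext => x; rewrite -{1}[x]g'K fK.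
move: fK f'K; rewrite fg' => fK f'K.
by congr LieAut; apply: Prop_irrelevance.
Qed.

HB.instance Definition _ := gen_eqMixin (lie_aut L).
HB.instance Definition _ := gen_choiceMixin (lie_aut L).

Definition aut_one : lie_aut L :=
  @LieAut K L id id (fun _ _ _ => erefl) (fun _ _ => erefl)
    (fun _ => erefl) (fun _ => erefl).

Fact aut_mulDZ f g (a : K) (x y : L) :
  (f \o g) (a *: x + y) = a *: (f \o g) x + (f \o g) y.
Proof. by rewrite /= !autDZ. Qed.

Fact aut_mul_lie f g (x y : L) :
  (f \o g) (lie x y) = lie ((f \o g) x) ((f \o g) y).
Proof. by rewrite /= !aut_lie. Qed.

Definition aut_mul f g : lie_aut L :=
  LieAut (aut_mulDZ f g) (aut_mul_lie f g)
    (can_comp (@autK _ _ f) (@autK _ _ g))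
    (can_comp (@aut_invK _ _ g) (@aut_invK _ _ f)).

Fact aut_invDZ f (a : K) (x y : L) :
  aut_inv f (a *: x + y) = a *: aut_inv f x + aut_inv f y.
Proof. by apply: (can_inj (@autK _ _ f)); rewrite autDZ !aut_invK. Qed.

Fact aut_inv_lie f (x y : L) :
  aut_inv f (lie x y) = lie (aut_inv f x) (aut_inv f y).
Proof. by apply: (can_inj (@autK _ _ f)); rewrite aut_lie !aut_invK. Qed.

Definition aut_V f : lie_aut L :=
  LieAut (aut_invDZ f) (aut_inv_lie f) (@aut_invK _ _ f) (@autK _ _ f).

Fact aut_mulA : associative aut_mul.
Proof. by move=> f g h; apply: lie_autP. Qed.

Fact aut_mul1 : left_id aut_one aut_mul.
Proof. by move=> f; apply: lie_autP. Qed.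

Fact aut_mulr1 : right_id aut_one aut_mul.
Proof. by move=> f; apply: lie_autP. Qed.

Fact aut_mulV : left_inverse aut_one aut_V aut_mul.
Proof. by move=> f; apply: lie_autP => x /=; rewrite autK. Qed.

Fact aut_mulrV : right_inverse aut_one aut_V aut_mul.
Proof. by move=> f; apply: lie_autP => x /=; rewrite aut_invK. Qed.

HB.instance Definition _ := isGroup.Build (lie_aut L)
  aut_mulA aut_mul1 aut_mulr1 aut_mulV aut_mulrV.

End AutGroup.

Section Graded.
Variables (K : comPzRingType) (L : lieAlgType K).
Implicit Types (E x y : L) (i j : int).

Definition ad x : L -> L := lie x.

(* [grade E 1], [grade E 0], [grade E (-1)] are $\mathfrak g_+$,
   $\mathfrak g_0$, $\mathfrak g_-$. *)
Definition grade E i : set L :=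
  if (`|i| <= 1)%R then [set x | ad E x = i%:~R *: x] else [set 0].

(* The last clause uses that [grade E i] is zero for $|i|\ge 2$, so that
   e.g. $[\mathfrak g_+,\mathfrak g_+]=0$. *)
Definition three_graded E : Prop :=
  [/\ forall x, ad E (ad E (ad E x)) = ad E x,
      forall x, exists a b c,
        [/\ grade E 1 a, grade E 0 b, grade E (-1) c & x = a + b + c],
      forall a b c, grade E 1 a -> grade E 0 b -> grade E (-1) c ->
        a + b + c = 0 -> [/\ a = 0, b = 0 & c = 0]
    & forall i j x y, grade E i x -> grade E j y ->
        grade E (i + j) (lie x y)].

(* $e^{\mathrm{ad}\,x}$; the series stops here because $(\mathrm{ad}\,x)^3=0$
   for $x\in\mathfrak g_\pm$. *)
Definition exp_ad x (y : L) : L := y + ad x y + inv2 K *: ad x (ad x y).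

(* The automorphisms $e^{\mathrm{ad}\,x}$, $x\in\mathfrak g_+\cup\mathfrak g_-$;
   see [exp_ad_aut] below. *)
Definition exp_auts E : set (lie_aut L) :=
  [set f : lie_aut L |
    exists2 x, (grade E 1 `|` grade E (-1)) x & f =1 exp_ad x].

Definition elem_auts E : set (lie_aut L) :=
  smallest [set A | group_closed (mem A)] (exp_auts E).

Definition elem_group E : Type := {f : lie_aut L | f \in elem_auts E}.

Fact elem_auts_closed E : group_closed (mem (elem_auts E)).
Proof.
split=> [|f g /set_mem Gf /set_mem Gg]; apply/mem_set => A [cA sA].
  exact/set_mem/cA.1.
by apply/set_mem/cA.2; apply/mem_set; [apply: Gf|apply: Gg].
Qed.

HB.instance Definition _ E := SubChoice.on (elem_group E).
HB.instance Definition _ E := SubChoice_isSubGroup.Build (lie_aut L)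
  (mem (elem_auts E)) (elem_group E) (elem_auts_closed E).

(* [Ugroup E 1] and [Ugroup E (-1)] are $U^+$ and $U^-$; likewise for [Pgroup]. *)
Definition Ugroup E i : set (elem_group E) :=
  [set u : elem_group E | exists2 x, grade E i x & val u =1 exp_ad x].

Definition Hgroup E : set (elem_group E) :=
  [set h : elem_group E | forall x, val h (ad E x) = ad E (val h x)].

Arguments Ugroup : clear implicits.
Arguments Hgroup : clear implicits.

Definition Pgroup E i : set (elem_group E) :=
  [set (h * u)%g | h in Hgroup E & u in Ugroup E i].

End Graded.

Arguments Ugroup {K L} E i.
Arguments Hgroup {K L} E.
Arguments Pgroup {K L} E i.

(* [E'] is the witness $\underline E\in\underline{\mathfrak g}$; since the
   grading of $\underline{\mathfrak g}$ consists of the eigenspaces of its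
   adjoint action, [ad E'] is the grading derivation of [sub_lie S]. *)
Definition inner_graded_subalgebra (K : comPzRingType) (L : lieAlgType K)
    (E : L) (S : lieClosed L) (E' : sub_lie S) : Prop :=
  [/\ three_graded E',
      val @` grade E' 1 = grade E 1,
      val @` grade E' 0 = [set` S] `&` grade E 0
    & val @` grade E' (-1) = grade E (-1)].

(* The generators of [elem_auts] do exist: [exp_ad x] is an automorphism for
   every $x\in\mathfrak g_\pm$. *)
Section ExpAut.
Variables (K : comPzRingType) (L : lieAlgType K).
Hypotheses (K2 : nat_invertible K 2) (K3 : nat_invertible K 3).
Implicit Types (E x y z : L).

Lemma lieDr x y z : lie x (y + z) = lie x y + lie x z.
Proof. by have := lieDZr 1 y z x; rewrite !scale1r. Qed.

Lemma lieDl x y z : lie (x + y) z = lie x z + lie y z.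
Proof. by have := lieDZl 1 x y z; rewrite !scale1r. Qed.

Lemma lier0 x : lie x 0 = 0.
Proof. by apply: (addrI (lie x 0)); rewrite -lieDr !addr0. Qed.

Lemma lie0r x : lie 0 x = 0.
Proof. by apply: (addrI (lie 0 x)); rewrite -lieDl !addr0. Qed.

Lemma lieZr a x y : lie x (a *: y) = a *: lie x y.
Proof. by have := lieDZr a y 0 x; rewrite lier0 !addr0. Qed.

Lemma lieZl a x y : lie (a *: x) y = a *: lie x y.
Proof. by have := lieDZl a x 0 y; rewrite lie0r !addr0. Qed.

Lemma lieC x y : lie x y = - lie y x.
Proof.
apply/eqP; rewrite -addr_eq0; apply/eqP.
by have := liexx (x + y); rewrite lieDr !lieDl !liexx add0r addr0 addrC.
Qed.

Lemma lieNr x y : lie x (- y) = - lie x y.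
Proof. by rewrite -scaleN1r lieZr scaleN1r. Qed.

Lemma lieNl x y : lie (- x) y = - lie x y.
Proof. by rewrite -scaleN1r lieZl scaleN1r. Qed.

Lemma lie_der x y z : lie x (lie y z) = lie (lie x y) z + lie y (lie x z).
Proof.
apply/eqP; rewrite -subr_eq0; apply/eqP; rewrite -[RHS](lie_jacobi x y z).
by rewrite opprD [lie (lie x y) z]lieC [lie x z]lieC lieNr !opprK addrAC addrA.
Qed.

Lemma cancel_nat n (v : L) : nat_invertible K n -> v *+ n = 0 -> v = 0.
Proof.
by case=> c nc vn; rewrite -[v]scale1r -nc mulrC -scalerA scaler_nat vn scaler0.
Qed.

Lemma inv2_mul2 (v : L) : (inv2 K *: v) *+ 2 = v.
Proof. by rewrite -scaler_nat scalerA inv2E // scale1r. Qed.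

Lemma ad_nilp E x : three_graded E -> (grade E 1 `|` grade E (-1)) x ->
  forall y, ad x (ad x (ad x y)) = 0.
Proof.
move=> [_ dec _ gr] gx y; have [a [b [c [ga gb gc ->]]]] := dec y.
rewrite /ad !lieDr; case: gx => gx.
- have := gr _ _ _ _ gx (gr _ _ _ _ gx (gr _ _ _ _ gx ga)).
  have := gr _ _ _ _ gx (gr _ _ _ _ gx (gr _ _ _ _ gx gb)).
  have := gr _ _ _ _ gx (gr _ _ _ _ gx (gr _ _ _ _ gx gc)).
  by rewrite /grade /= => -> -> ->; rewrite !addr0.
- have := gr _ _ _ _ gx (gr _ _ _ _ gx (gr _ _ _ _ gx ga)).
  have := gr _ _ _ _ gx (gr _ _ _ _ gx (gr _ _ _ _ gx gb)).
  have := gr _ _ _ _ gx (gr _ _ _ _ gx (gr _ _ _ _ gx gc)).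
  by rewrite /grade /= => -> -> ->; rewrite !addr0.
Qed.

Lemma exp_adK x : (forall y, ad x (ad x (ad x y)) = 0) ->
  cancel (exp_ad x) (exp_ad (- x)).
Proof.
rewrite /exp_ad /ad => x3 y; set p := lie x y; set q := lie x p.
have e1 : lie x (y + p + inv2 K *: q) = p + q.
  by rewrite !lieDr lieZr x3 scaler0 addr0.
rewrite !lieNl lieNr opprK e1 lieDr x3 addr0 -/q.
by rewrite addrAC -[_ + _ + inv2 K *: q]addrA -mulr2n inv2_mul2 -[y + p + q]addrA addrK.
Qed.

Lemma exp_ad_lie x : (forall y, ad x (ad x (ad x y)) = 0) ->
  forall y z, exp_ad x (lie y z) = lie (exp_ad x y) (exp_ad x z).
Proof.
rewrite /exp_ad /ad => x3 y z.
set p := lie x y; set pp := lie x p; set q := lie x z; set qq := lie x q.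
have d1 : lie x (lie y z) = lie p z + lie y q by apply: lie_der.
have d2 : lie x (lie x (lie y z)) = lie pp z + lie p q *+ 2 + lie y qq.
  by rewrite d1 lieDr (lie_der x p) (lie_der x y) mulr2n !addrA.
have d3 : lie pp q + lie p qq = 0.
  apply: (cancel_nat K3); rewrite -(x3 (lie y z)) /ad d2 mulr2n !lieDr.
  rewrite (lie_der x pp) (lie_der x p) (lie_der x y) -/p -/q -/pp -/qq.
  rewrite [lie x pp]x3 [lie x qq]x3 lie0r lier0 add0r addr0.
  by rewrite [RHS]addrAC mulrS mulr2n.
have d4 : lie pp qq = 0.
  apply: (cancel_nat K2); rewrite -(lier0 x) -d3 lieDr.
  rewrite (lie_der x pp) (lie_der x p) -/pp -/qq [lie x pp]x3 [lie x qq]x3.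
  by rewrite lie0r lier0 add0r addr0 mulr2n.
rewrite d2 d1 !scalerDr -mulr2n inv2_mul2.
rewrite !(lieDr, lieDl) !(lieZr, lieZl) d4 !scaler0 addr0.

rewrite [RHS](AC (3*3*2) (1*(2*4)*(3*5*7)*(6*8)))/=.
by rewrite -[inv2 K *: lie pp q + _]scalerDr d3 scaler0 addr0.
Qed.

Lemma exp_ad_aut E x : three_graded E -> (grade E 1 `|` grade E (-1)) x ->
  exists f : lie_aut L, f =1 exp_ad x.
Proof.
move=> gE gx; have x3 := ad_nilp gE gx.
have Nx3 y : ad (- x) (ad (- x) (ad (- x) y)) = 0.
  by rewrite /ad !(lieNl, lieNr) [lie x _]x3 !oppr0.
have expDZ (a : K) (y z : L) : exp_ad x (a *: y + z) = a *: exp_ad x y + exp_ad x z.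
  rewrite /exp_ad /ad !(lieDr, lieZr) !scalerDr scalerA mulrC -scalerA.
  by rewrite [LHS](AC (2*2*2) ((1*3*5)*(2*4*6)))/= .
have NxK : cancel (exp_ad (- x)) (exp_ad x).
  by rewrite -{2}[x]opprK; apply: exp_adK.
by exists (LieAut expDZ (exp_ad_lie x3) (exp_adK x3) NxK).
Qed.

End ExpAut.

Section Cosets.
Variable T : groupType.
Implicit Types (g : T) (A : set T).

Definition left_coset g A : set T := [set (g * a)%g | a in A].

(* $T/A$, for $A$ a subgroup of $T$. *)
Definition left_cosets A : Type := {C : set T | exists g, C = left_coset g A}.

Fact left_coset_mul g A (C : left_cosets A) :
  exists g', left_coset g (sval C) = left_coset g' A.
Proof.
case: C => _ /= [g' ->]; exists (g * g')%g; rewrite /left_coset image_comp.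
by congr image; apply: funext => a /=; rewrite mulgA.
Qed.

Definition coset_act A g (C : left_cosets A) : left_cosets A :=
  exist _ (left_coset g (sval C)) (left_coset_mul g C).

End Cosets.

Definition isomorphic_actions (G X Y : Type)
    (aX : G -> X -> X) (aY : G -> Y -> Y) : Prop :=
  exists2 phi : X -> Y, bijective phi & forall g x, phi (aX g x) = aY g (phi x).

(* Main.v *)
Require Import Defs.
From HB Require Import structures.
From mathcomp Require Import all_boot all_order all_algebra.
From mathcomp Require Import boolp classical_sets.

(** Every generator $e^{\mathrm{ad}\,x}$ of $G$ has its $x$ in the subalgebra
    $S = \underline{\mathfrak g}$ and is a polynomial in $\mathrm{ad}\,x$.  It
    therefore preserves $S$ and restricts to the generator of $\underline G$
    with the same $x$; conversely every generator of $\underline G$ arises in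
    this way.  As both properties pass to quotients $f g^{-1}$, restriction is a
    surjective homomorphism $R : G \to \underline G$
    ([elem_auts_restrict], [elem_auts_extend]).

    Commuting with the grading derivation means preserving every graded piece
    ([commute_adP]), and the graded pieces of $S$ are the traces on $S$ of those
    of $\mathfrak g$ ([gradeS]).  Hence $R(H) \subseteq \underline H$, and for
    the converse the only question is whether $f \in G$ preserves
    $\mathfrak g_0$ as soon as its restriction commutes with
    $\mathrm{ad}\,\underline E$.  Let $z \in \mathfrak g_0$.  Then
    $w = [\underline E, z]$ commutes with $\mathfrak g_\pm$, because both
    $\underline E$ and $E$ act there by $\pm 1$; hence all of $G$ fixes $w$
    ([elem_auts_fix]).  Writing $f z = a + b + c$ along the grading, and using
    that $f \underline E$ has degree $0$ and still acts by $\pm 1$ on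
    $\mathfrak g_\pm$, one gets
    $w = f w = [f \underline E, f z] = a + [f \underline E, b] - c$.
    Since $w$ has degree $0$, $a = c = 0$ ([elem_auts_grade0]).

    The statement on $P^\pm$ follows from the one on $H$, since
    $R(U^\pm) = \underline U^\pm$.  Finally, for a surjective homomorphism $R$
    and any subset $B$ of its target, taking preimages is an equivariant
    bijection from the left translates of $B$ to those of $R^{-1}(B)$
    ([isomorphic_left_cosets]). *)

Import GRing.Theory.
Local Open Scope classical_set_scope.
Local Open Scope ring_scope.

(** * Left cosets along a surjective homomorphism *)

Section Cosets.
Set Implicit Arguments.
Unset Strict Implicit.
Variables (T T' : groupType) (R : {multiplicative T -> T'}).

(** Cancellation in the target forces [R 1 = 1], so a map between groups that
    is only known to preserve products also preserves inverses. *)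
Lemma multiplicativeV (x : T) : R x^-1%g = (R x)^-1%g.
Proof.
have R1 : R 1%g = 1%g by apply: (mulgI (R 1%g)); rewrite -gmulfM !mulg1.
by apply: (mulgI (R x)); rewrite -gmulfM !mulgV.
Qed.

Lemma left_cosetP (U : groupType) (g x : U) (A : set U) :
  left_coset g A x <-> A (g^-1 * x)%g.
Proof.
split=> [[a Aa <-]|Ax]; first by rewrite mulKg.
by exists (g^-1 * x)%g; rewrite ?mulVKg.
Qed.

Lemma preimage_left_coset (g : T) (B : set T') :
  R @^-1` left_coset (R g) B = left_coset g (R @^-1` B).
Proof.
apply/predeqP => x; split=> [/left_cosetP Bx|/left_cosetP Bx];
  by apply/left_cosetP; move: Bx; rewrite /preimage /= gmulfM multiplicativeV.
Qed.

Lemma left_cosets_inj (U : groupType) (A : set U) :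
  injective (fun C : left_cosets A => sval C).
Proof. by move=> [C cC] [D cD] /= CD; apply: eq_exist. Qed.

(** Injectivity and surjectivity of the preimage map both come from the
    surjectivity of [R]: it makes the direct image a left inverse, and it lets
    every translate of [B] be written as a translate by some [R g]. *)
Lemma isomorphic_left_cosets (A : set T) (B : set T') :
  (forall y, exists x, R x = y) -> R @^-1` B = A ->
  isomorphic_actions
    (fun f (C : left_cosets B) => coset_act (R f) C)
    (fun f (C : left_cosets A) => coset_act f C).
Proof.
move=> Rsurj <-{A}.
have imK : cancel (preimage R) (image^~ R).
  move=> C; apply: image_preimage; apply/predeqP => y; split=> // _.
  by have [x <-] := Rsurj y; exists x.
have pre_coset (C : left_cosets B) :
    exists g, R @^-1` (sval C) = left_coset g (R @^-1` B).
  case: C => _ /= [g' ->]; have [g <-] := Rsurj g'.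
  by exists g; apply: preimage_left_coset.
have im_coset (C : left_cosets (R @^-1` B)) :
    exists g', R @` (sval C) = left_coset g' B.
  by case: C => _ /= [g ->]; exists (R g); rewrite -preimage_left_coset imK.
exists (fun C => exist _ (R @^-1` sval C) (pre_coset C)).
  exists (fun C => exist _ (R @` sval C) (im_coset C)) => C;
    apply: left_cosets_inj => /=; first exact: imK.
  by case: C => _ /= [g ->]; rewrite -preimage_left_coset imK.
by move=> g C; apply: left_cosets_inj => /=; rewrite preimage_left_coset.
Qed.

End Cosets.

(** * Graded pieces and the elementary group *)

Section Graded.
Set Implicit Arguments.
Unset Strict Implicit.
Variables (K : comPzRingType) (L : lieAlgType K).
Implicit Types (E x y : L) (f g : lie_aut L).

Lemma aut0 f : f 0 = 0.
Proof.
by have := autDZ f (-1) 0 0; rewrite !scaleN1r oppr0 addr0 addNr.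
Qed.

Lemma autD f x y : f (x + y) = f x + f y.
Proof. by have := autDZ f 1 x y; rewrite !scale1r. Qed.

Lemma autZ f (a : K) x : f (a *: x) = a *: f x.
Proof. by have := autDZ f a x 0; rewrite aut0 !addr0. Qed.

Lemma grade1 E x : grade E 1 x <-> lie E x = x.
Proof. by rewrite /grade /= /ad mulr1z scale1r. Qed.

Lemma grade0 E x : grade E 0 x <-> lie E x = 0.
Proof. by rewrite /grade /= /ad mulr0z scale0r. Qed.

Lemma gradeN1 E x : grade E (-1) x <-> lie E x = - x.
Proof. by rewrite /grade /= /ad mulrNz mulr1z scaleN1r. Qed.

Lemma degree_cases (i : int) :
  [\/ i = 1, i = 0, i = -1 | (`|i| <= 1) = false].
Proof.
by case: i => [[|[|n]]|[|n]]; [constructor 2|constructor 1|constructor 4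
  |constructor 3|constructor 4].
Qed.

(** A linear map commutes with $\mathrm{ad}\,E$ iff it preserves the graded
    pieces: these are its eigenspaces, and they span. *)
Lemma commute_adP E f : three_graded E ->
  (forall x, f (ad E x) = ad E (f x)) <->
  (forall i x, grade E i x -> grade E i (f x)).
Proof.
move=> [_ dec _ _]; split=> [fE i x|fgr x].
  rewrite /grade; case: ifP => _ /=; last by move=> ->; rewrite aut0.
  by rewrite -fE => ->; rewrite autZ.
have [a [b [c [ga gb gc ->]]]] := dec x.
have /grade1 ga' := fgr _ _ ga; have /grade0 gb' := fgr _ _ gb.
have /gradeN1 gc' := fgr _ _ gc.
move/grade1: ga => ga; move/grade0: gb => gb; move/gradeN1: gc => gc.
rewrite /ad !autD !lieDr ga gb gc ga' gb' gc' !autD aut0 -scaleN1r autZ.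
by rewrite scaleN1r.
Qed.

Lemma elem_auts_ind E (P : lie_aut L -> Prop) :
    P 1%g -> (forall f g, P f -> P g -> P (f * g^-1)%g) ->
    (forall x f, (grade E 1 `|` grade E (-1)) x -> f =1 exp_ad x -> P f) ->
  forall f, elem_auts E f -> P f.
Proof.
move=> P1 PV Pexp f; apply; split=> [|h [x gx hx]]; last exact: Pexp gx hx.
split=> [|h k /set_mem Ph /set_mem Pk]; apply/mem_set => //.
exact: PV.
Qed.

Lemma elem_auts1 E : elem_auts E 1%g.
Proof. exact/set_mem/(elem_auts_closed E).1. Qed.

Lemma elem_autsV E f g :
  elem_auts E f -> elem_auts E g -> elem_auts E (f * g^-1)%g.
Proof.
by move=> Gf Gg; apply/set_mem/(elem_auts_closed E).2; apply/mem_set.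
Qed.

Lemma elem_auts_exp E x f :
  (grade E 1 `|` grade E (-1)) x -> f =1 exp_ad x -> elem_auts E f.
Proof. by move=> gx fx A [_ sA]; apply: sA; exists x. Qed.

(** The fixer of [w] is a group, and $e^{\mathrm{ad}\,x}$ belongs to it when
    $[x, w] = 0$. *)
Lemma elem_auts_fix E w : (forall x, (grade E 1 `|` grade E (-1)) x ->
    lie x w = 0) ->
  forall f, elem_auts E f -> f w = w.
Proof.
move=> cw; apply: elem_auts_ind => //= [f g fw gw|x f gx ->].
  by change (f (aut_inv g w) = w); rewrite -{1}gw autK fw.
by rewrite /exp_ad /ad (cw _ gx) lier0 scaler0 !addr0.
Qed.

(** Since [T] and [E] act alike on $\mathfrak g_\pm$, $[T, z]$ commutes with
    $\mathfrak g_\pm$ and is fixed by [f].  As $f T$ acts there in the same way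
    too, the components of $[T, z] = [f T, f z]$ in degree $\pm 1$, which are
    zero, are up to sign those of $f z$. *)
Lemma elem_auts_grade0 E T f z : three_graded E ->
    grade E 0 T -> grade E 0 (f T) ->
    (forall x, (grade E 1 `|` grade E (-1)) x -> lie T x = lie E x) ->
    (forall x, (grade E 1 `|` grade E (-1)) x -> lie (f T) x = lie E x) ->
    elem_auts E f -> grade E 0 z ->
  grade E 0 (f z).
Proof.
move=> [_ dec uniq gr] gT gfT TE fTE Gf gz.
have gw : grade E 0 (lie T z) by have := gr _ _ _ _ gT gz; rewrite addr0.
have fw : f (lie T z) = lie T z.
  apply: elem_auts_fix Gf => x gx.
  have gzx : (grade E 1 `|` grade E (-1)) (lie z x).
    by case: gx => gx; [left|right]; have := gr _ _ _ _ gz gx; rewrite add0r.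
  apply/eqP; rewrite lieC oppr_eq0; apply/eqP.
  have := lie_der T z x; rewrite (TE _ gzx) (TE _ gx) (lie_der E).
  by move/grade0: (gz) => ->; rewrite lie0r => /addIr <-.
have [a [b [c [ga gb gc def_fz]]]] := dec (f z).
have lfTa : lie (f T) a = a by rewrite fTE; [apply/grade1|left].
have lfTc : lie (f T) c = - c by rewrite fTE; [apply/gradeN1|right].
have gb' : grade E 0 (lie (f T) b - lie T z).
  have /grade0 gfTb : grade E 0 (lie (f T) b).
    by have := gr _ _ _ _ gfT gb; rewrite addr0.
  by apply/grade0; move/grade0: gw => gw; rewrite lieDr lieNr gw gfTb subrr.
have gc' : grade E (-1) (- c).
  by apply/gradeN1; move/gradeN1: gc => gc; rewrite lieNr gc.
have sum0 : a + (lie (f T) b - lie T z) + - c = 0.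
  apply/eqP; rewrite addrA [_ - c]addrAC subr_eq0 -fw aut_lie def_fz !lieDr.
  by rewrite lfTa lfTc.
have [a0 _ /eqP] := uniq _ _ _ ga gb' gc' sum0.
by rewrite oppr_eq0 => /eqP c0; rewrite def_fz a0 c0 add0r addr0.
Qed.

End Graded.

(** * Restriction to an inner graded subalgebra *)

Section Restriction.
Set Implicit Arguments.
Unset Strict Implicit.
Variables (K : comPzRingType) (L : lieAlgType K).
Hypotheses (K2 : nat_invertible K 2) (K3 : nat_invertible K 3).
Variables (E : L) (gE : three_graded E).
Variables (S : lieClosed L) (E' : sub_lie S).
Hypothesis (SE : inner_graded_subalgebra E E').

Definition restricts (f : lie_aut L) (f' : lie_aut (sub_lie S)) : Prop :=
  forall x : sub_lie S, val (f' x) = f (val x).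

Lemma val_exp_ad (x y : sub_lie S) :
  val (exp_ad x y) = exp_ad (val x) (val y).
Proof. by []. Qed.

Lemma gradeS i (x : sub_lie S) : grade E' i x <-> grade E i (val x).
Proof.
have img j : val @` grade E' j = grade E j ->
    grade E' j x <-> grade E j (val x).
  by move=> <-; split=> [gx|[y gy /val_inj <-]] //; exists x.
case: SE => _ s1 s0 sN1; case: (degree_cases i) => [->|->|->|out].
- exact: img.
- have -> : grade E 0 (val x) <-> (val @` grade E' 0) (val x).
    by rewrite s0; split=> [gx|[]] //; split=> //; apply: valP.
  by split=> [gx|[y gy /val_inj <-]] //; exists x.
- exact: img.
- by rewrite /grade out; split=> [->|x0] //; apply: val_inj.
Qed.

Lemma gradeS_lift (i : int) x : grade E i x -> i = 1 \/ i = -1 ->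
  exists2 x' : sub_lie S, grade E' i x' & val x' = x.
Proof.
case: SE => _ s1 _ sN1 gx i1; case: i1 gx => ->; rewrite -?s1 -?sN1;
  by case=> x' gx' <-; exists x'.
Qed.

Lemma restrictsV f f' g g' :
  restricts f f' -> restricts g g' -> restricts (f * g^-1)%g (f' * g'^-1)%g.
Proof.
move=> rf rg x; change (val (f' (aut_inv g' x)) = f (aut_inv g (val x))).
by rewrite rf -{2}[x](@aut_invK _ _ g' _) rg autK.
Qed.

(** The set of automorphisms that have such a restriction is a group, and it
    contains each $e^{\mathrm{ad}\,x}$, as $x$ lies in the subalgebra. *)
Lemma elem_auts_restrict f :
  elem_auts E f -> exists2 f', elem_auts E' f' & restricts f f'.
Proof.
have [gE' _ _ _] := SE; move: f.
apply: elem_auts_ind => [|f g [f' Gf' rf] [g' Gg' rg]|x f gx fx].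
- by exists 1%g => //; apply: elem_auts1.
- by exists (f' * g'^-1)%g; [apply: elem_autsV|apply: restrictsV].
have [x' gx' def_x] : exists2 x' : sub_lie S,
    (grade E' 1 `|` grade E' (-1)) x' & val x' = x.
  by case: gx => /gradeS_lift [|x' gx' <-]; auto; exists x' => //; [left|right].
have [f' f'x] := exp_ad_aut K2 K3 gE' gx'.
exists f' => [|y]; first exact: elem_auts_exp gx' f'x.
by rewrite f'x fx val_exp_ad def_x.
Qed.

Lemma elem_auts_extend f' :
  elem_auts E' f' -> exists2 f, elem_auts E f & restricts f f'.
Proof.
move: f'; apply: elem_auts_ind => [|f' g' [f Gf rf] [g Gg rg]|x' f' gx' fx'].
- by exists 1%g => //; apply: elem_auts1.
- by exists (f * g^-1)%g; [apply: elem_autsV|apply: restrictsV].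
have gx : (grade E 1 `|` grade E (-1)) (val x').
  by case: gx' => /gradeS; [left|right].
have [f fx] := exp_ad_aut K2 K3 gE gx.
by exists f => [|y]; [apply: elem_auts_exp gx fx|rewrite fx fx' val_exp_ad].
Qed.

(** By [commute_adP] the claim is about graded pieces, and from left to right
    it follows from [gradeS].  From right to left, degrees $\pm 1$
    are clear because $\mathfrak g_\pm$ lies in the subalgebra; degree $0$,
    where $\mathfrak g_0$ may be larger, is [elem_auts_grade0] with
    [T = val E']. *)
Lemma restricts_commute f f' : elem_auts E f -> restricts f f' ->
  (forall x, f (ad E x) = ad E (f x)) <->
  (forall x, f' (ad E' x) = ad E' (f' x)).
Proof.
move=> Gf rf; have [gE' _ _ _] := SE; split.
  move=> /(commute_adP f gE) fgr; apply/(commute_adP f' gE') => i x.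
  by move=> /gradeS/fgr gfx; apply/gradeS; rewrite rf.
move=> fE'; have /(commute_adP f' gE') f'gr := fE'.
apply/(commute_adP f gE).
have fgr1 (i : int) x : i = 1 \/ i = -1 -> grade E i x -> grade E i (f x).
  move=> i1 /gradeS_lift/(_ i1) [x' gx' <-].
  by rewrite -rf; apply/gradeS/f'gr.
have gE'0 : grade E' 0 E' by apply/grade0; apply: liexx.
have E'E x : (grade E 1 `|` grade E (-1)) x -> lie (val E') x = lie E x.
  case=> gx; have [|x' gx' def_x] := gradeS_lift gx; auto.
    move/grade1: gx => ->; move/grade1: gx' => gx'.
    by rewrite -def_x -val_lie gx'.
  move/gradeN1: gx => ->; move/gradeN1: gx' => gx'.
  by rewrite -def_x -val_lie gx'.
(* Conjugating by [f'] leaves [ad E'] unchanged, so [f' E'] can differ from [E']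
   only by a central element of the subalgebra. *)
have f'E' x' : lie (f' E') x' = lie E' x'.
  by rewrite -[x'](@aut_invK _ _ f' _) -aut_lie fE'.
move=> i x; case: (degree_cases i) => [->|->|->|out]; try by apply: fgr1; auto.
- move=> gx; apply: (elem_auts_grade0 (T := val E')) Gf gx => //.
  + exact/gradeS.
  + by rewrite -rf; apply/gradeS/f'gr.
  move=> y gy; rewrite -(E'E _ gy) -rf.
  have [y' <-] : exists y' : sub_lie S, val y' = y.
    by case: gy => /gradeS_lift [|y' _ <-]; auto; exists y'.
  by rewrite -!val_lie f'E'.
by rewrite /grade out => ->; apply: aut0.
Qed.

Lemma restriction_morphism :
  exists R : {multiplicative elem_group E -> elem_group E'},
    forall f, restricts (val f) (val (R f)).
Proof.
have restr (f : elem_group E) :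
    {f' : elem_group E' | restricts (val f) (val f')}.
  apply: cid; have [f' Gf' rf] := elem_auts_restrict (set_mem (valP f)).
  by exists (Sub f' (mem_set Gf')); rewrite SubK.
have restrM : {morph (fun f => sval (restr f)) : f g / (f * g)%g}.
  move=> f g; apply/val_inj/lie_autP => x; apply/val_inj.
  rewrite (svalP (restr (f * g)%g)).
  change (val f (val g (val x)) =
    val (val (sval (restr f)) (val (sval (restr g)) x))).
  by rewrite (svalP (restr f)) (svalP (restr g)).
pose mR := isMultiplicative.Build _ _ (fun f => sval (restr f)) restrM.
pose R : {multiplicative elem_group E -> elem_group E'} :=
  HB.pack (fun f => sval (restr f)) mR.
by exists R => f; apply: svalP (restr f).
Qed.

Section Preimages.
Variable R : {multiplicative elem_group E -> elem_group E'}.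
Hypothesis Rrestr : forall f, restricts (val f) (val (R f)).

Lemma restriction_surj f' : exists f, R f = f'.
Proof.
have [f Gf rf] := elem_auts_extend (set_mem (valP f')).
exists (Sub f (mem_set Gf)); apply/val_inj/lie_autP => x; apply/val_inj.
by rewrite Rrestr SubK rf.
Qed.

Lemma restriction_preimageH : R @^-1` Hgroup E' = Hgroup E.
Proof.
apply/predeqP => f; symmetry.
exact: restricts_commute (set_mem (valP f)) (Rrestr f).
Qed.

Lemma restriction_U (x : sub_lie S) (u : elem_group E) :
  val u =1 exp_ad (val x) -> val (R u) =1 exp_ad x.
Proof. by move=> ux y; apply/val_inj; rewrite Rrestr ux val_exp_ad. Qed.

(** If $R f = h' u'$, the factor $u' = e^{\mathrm{ad}\,x}$ lifts to
    $u \in U^\pm$ with the same $x$, and $f u^{-1}$ lies in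
    $R^{-1}(\underline H) = H$. *)
Lemma restriction_preimageP (i : int) :
  i = 1 \/ i = -1 -> R @^-1` Pgroup E' i = Pgroup E i.
Proof.
move=> i1; apply/predeqP => f; split.
  case=> h' Hh' [u' [x' gx' u'x] def_Rf].
  have gx : (grade E 1 `|` grade E (-1)) (val x').
    by case: i1 gx' => -> /gradeS; [left|right].
  have [v vx] := exp_ad_aut K2 K3 gE gx.
  pose u : elem_group E := Sub v (mem_set (elem_auts_exp gx vx)).
  have Ru : R u = u'.
    by apply/val_inj/lie_autP => y; rewrite u'x; apply: restriction_U => z.
  exists (f * u^-1)%g.
    rewrite -restriction_preimageH /preimage /= gmulfM multiplicativeV Ru.
    by rewrite -def_Rf mulgK.
  by exists u; [exists (val x') => //; apply/gradeS|rewrite mulgVK].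
case=> h; rewrite -restriction_preimageH => Hh [u [x gx ux] <-].
have [x' gx' def_x] := gradeS_lift gx i1.
exists (R h) => //; exists (R u); last by rewrite gmulfM.
by exists x' => //; apply: restriction_U; rewrite def_x.
Qed.

End Preimages.
End Restriction.

Theorem theorem6p6 (K : comPzRingType)
    (K2 : nat_invertible K 2) (K3 : nat_invertible K 3)
    (g : lieAlgType K) (E : g) (gE : three_graded E)
    (S : lieClosed g) (E' : sub_lie S) (SE : inner_graded_subalgebra E E') :
  exists R : {multiplicative elem_group E -> elem_group E'},
    [/\ forall (f : elem_group E) (x : sub_lie S),
          val (val (R f) x) = val f (val x),
        forall f' : elem_group E', exists f : elem_group E, R f = f',
        R @^-1` Hgroup E' = Hgroup E,
        R @^-1` Pgroup E' 1 = Pgroup E 1 /\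
        R @^-1` Pgroup E' (-1) = Pgroup E (-1)
      & [/\ isomorphic_actions
              (fun f (C : left_cosets (Pgroup E' 1)) => coset_act (R f) C)
              (fun f (C : left_cosets (Pgroup E 1)) => coset_act f C),
            isomorphic_actions
              (fun f (C : left_cosets (Pgroup E' (-1))) => coset_act (R f) C)
              (fun f (C : left_cosets (Pgroup E (-1))) => coset_act f C)
          & isomorphic_actions
              (fun f (C : left_cosets (Hgroup E')) => coset_act (R f) C)
              (fun f (C : left_cosets (Hgroup E)) => coset_act f C)]].
Proof.
have [R Rrestr] := restriction_morphism K2 K3 SE.
have Rsurj := restriction_surj K2 K3 gE SE Rrestr.
have RH := restriction_preimageH gE SE Rrestr.
have RP1 := restriction_preimageP K2 K3 gE SE Rrestr (or_introl erefl).
have RPN := restriction_preimageP K2 K3 gE SE Rrestr (or_intror erefl).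
by exists R; split=> //; split; apply: isomorphic_left_cosets.
Qed.
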